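(* The $G'$-coalgebra $(I,\iota)$ given by the unit interval $[0,1]$ with its Euclidean topology, its two endpoints, and the doubling map is terminal in the category of $G'$-coalgebras.
   Context: For an endofunctor $G$ of a category $\mathcal{C}$, a $G$-coalgebra is a pair $(X,\xi)$ with $X\in\mathcal{C}$ and $\xi:X\to G(X)$; a map $(X,\xi)\to(X',\xi')$ is a map $h:X\to X'$ in $\mathcal{C}$ with $\xi'h=G(h)\xi$. $\mathcal{C}'$ is the category whose objects $X=(X_0,X_1,u,v)$ consist of (arbitrary) topological spaces $X_0,X_1$ and continuous closed injections $u,v:X_0\to X_1$ with disjoint images (a map is closed if the image of every closed set is closed), and whose maps $X\to X'$ are pairs of continuous maps $h_0:X_0\to X_0'$, $h_1:X_1\to X_1'$ with $h_1u=u'h_0$ and $h_1v=v'h_0$. The endofunctor $G'$ of $\mathcal{C}'$ glues two copies of $X$ end to end: $(G'(X))_0=X_0$; $(G'(X))_1$ is the pushout in topological spaces of $X_1\xleftarrow{\,v\,}X_0\xrightarrow{\,u\,}X_1$, with coprojections $\ell$ (first, ''left'' copy of $X_1$, glued along $v$) and $r$ (second, ''right'' copy, glued along $u$), so $\ell v=ru$; and the two structure maps $X_0\to(G'(X))_1$ are $\ell u$ and $rv$. On morphisms $G'$ is the evident induced map. $I=(\{\star\},[0,1],0,1)\in\mathcal{C}'$, where $0,1:\{\star\}\to[0,1]$ pick out the endpoints and $[0,1]$ has the Euclidean topology. Identify $(G'(I))_1$ with $[0,2]$ (left copy $=[0,1]$, right copy $=[1,2]$ via $t\mapsto t+1$),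 so that $G'(I)=(\{\star\},[0,2],0,2)$. The coalgebra structure $\iota:I\to G'(I)$ has $\iota_0=\mathrm{id}_{\{\star\}}$ and $\iota_1:[0,1]\to[0,2]$, $\iota_1(t)=2t$. *)

(* Defs.v *)
From HB Require Import structures.
From Stdlib Require Import Relation_Operators.
From mathcomp Require Import all_boot all_order all_algebra generic_quotient.
From mathcomp Require Import all_classical all_reals all_analysis.
From mathcomp Require Import lra.

Set Implicit Arguments.
Unset Strict Implicit.
Unset Printing Implicit Defensive.

Import Order.TTheory GRing.Theory Num.Theory.
Import numFieldNormedType.Exports.

Local Open Scope classical_set_scope.
Local Open Scope ring_scope.
Local Open Scope quotient_scope.

#[local] Obligation Tactic := idtac.

Record category := Category {
  obj :> Type;
  hom : obj -> obj -> Type;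
  idm : forall X, hom X X;
  compm : forall X Y Z, hom Y Z -> hom X Y -> hom X Z;
  compm_idl : forall X Y (f : hom X Y), compm (idm Y) f = f;
  compm_idr : forall X Y (f : hom X Y), compm f (idm X) = f;
  compmA : forall W X Y Z (h : hom Y Z) (g : hom X Y) (f : hom W X),
    compm h (compm g f) = compm (compm h g) f
}.

Definition is_terminal (C : category) (T : C) : Prop :=
  forall X : C, exists f : hom X T, forall g : hom X T, g = f.

Record endofunctor (C : category) := Endofunctor {
  fobj :> C -> C;
  fmap : forall X Y : C, hom X Y -> hom (fobj X) (fobj Y);
  fmap_id : forall X : C, fmap (idm X) = idm (fobj X);
  fmap_comp : forall (X Y Z : C) (g : hom Y Z) (f : hom X Y),
    fmap (compm g f) = compm (fmap g) (fmap f)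
}.

Section Coalgebras.
Variables (C : category) (G : endofunctor C).

Record coalgebra := Coalgebra {
  carrier : C;
  structure_map : hom carrier (G carrier)
}.

Definition coalgebra_hom (X X' : coalgebra) : Type :=
  {h : hom (carrier X) (carrier X') |
    compm (structure_map X') h = compm (fmap G h) (structure_map X)}.

Lemma coalgebra_hom_eq (X X' : coalgebra) (f g : coalgebra_hom X X') :
  sval f = sval g -> f = g.
Proof. exact: eq_sig_hprop. Qed.

Program Definition coalgebra_id (X : coalgebra) : coalgebra_hom X X :=
  idm (carrier X).
Next Obligation. by move=> X /=; rewrite fmap_id compm_idl compm_idr. Qed.

Program Definition coalgebra_comp (X Y Z : coalgebra)
    (g : coalgebra_hom Y Z) (f : coalgebra_hom X Y) : coalgebra_hom X Z :=
  compm (sval g) (sval f).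
Next Obligation.
by move=> X Y Z [g gP] [f fP] /=; rewrite compmA gP -compmA fP compmA fmap_comp.
Qed.

Program Definition coalgebra_category : category :=
  @Category coalgebra coalgebra_hom coalgebra_id coalgebra_comp _ _ _.
Next Obligation. by move=> X Y f; apply: coalgebra_hom_eq; exact: compm_idl. Qed.
Next Obligation. by move=> X Y f; apply: coalgebra_hom_eq; exact: compm_idr. Qed.
Next Obligation.
by move=> W X Y Z h g f; apply: coalgebra_hom_eq; exact: compmA.
Qed.

End Coalgebras.

Section Pushout.
Context {A B C : topologicalType} (f : A -> B) (g : A -> C).

Definition summand (b : bool) : topologicalType := if b then B else C.

Let inB (x : B) : {b & summand b} := existT summand true x.
Let inC (y : C) : {b & summand b} := existT summand false y.

Let inB_inj : injective inB.
Proof. by move=> x y E; exact: (@existT_inj2 _ summand true x y E). Qed.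

Let inC_inj : injective inC.
Proof. by move=> x y E; exact: (@existT_inj2 _ summand false x y E). Qed.

(* [summand true] is B and [summand false] is C; the pushout is the quotient of
   the disjoint sum by the equivalence relation generated by [f a ~ g a]. *)
Inductive glued : {b & summand b} -> {b & summand b} -> Prop :=
  Glued a : glued (inB (f a)) (inC (g a)).

Definition pushout_rel (x y : {b & summand b}) : bool :=
  `[< clos_refl_sym_trans _ glued x y >].

Lemma pushout_rel_refl : reflexive pushout_rel.
Proof. by move=> x; apply/asboolP; exact: rst_refl. Qed.

Lemma pushout_rel_sym : symmetric pushout_rel.
Proof.
by move=> x y; apply/asboolP/asboolP; exact: rst_sym.
Qed.

Lemma pushout_rel_trans : transitive pushout_rel.
Proof.
move=> y x z /asboolP xy /asboolP yz; apply/asboolP.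
exact: rst_trans xy yz.
Qed.

Definition pushout_equiv :=
  EquivRel pushout_rel pushout_rel_refl pushout_rel_sym pushout_rel_trans.

Definition pushout := {eq_quot pushout_equiv}.

HB.instance Definition _ := Topological.copy pushout (quotient_topology pushout).
HB.instance Definition _ := Quotient.on pushout.

Definition pushout_inl (x : B) : pushout := \pi_pushout (inB x).
Definition pushout_inr (y : C) : pushout := \pi_pushout (inC y).

Lemma pushout_glue a : pushout_inl (f a) = pushout_inr (g a).
Proof. by apply/eqmodP/asboolP; exact/rst_step. Qed.

Lemma pushout_inl_continuous : continuous pushout_inl.
Proof.
move=> x; apply: (@continuous_comp _ _ _ (existT summand true) \pi_pushout).
  exact: existT_continuous.
exact: pi_continuous.
Qed.

Lemma pushout_inr_continuous : continuous pushout_inr.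
Proof.
move=> x; apply: (@continuous_comp _ _ _ (existT summand false) \pi_pushout).
  exact: existT_continuous.
exact: pi_continuous.
Qed.

HB.instance Definition _ :=
  @isContinuous.Build _ _ pushout_inl pushout_inl_continuous.
HB.instance Definition _ :=
  @isContinuous.Build _ _ pushout_inr pushout_inr_continuous.

Lemma pushoutP (z : pushout) :
  (exists x, z = pushout_inl x) \/ (exists y, z = pushout_inr y).
Proof.
rewrite -[z]reprK; case: (repr z) => -[] x.
  by left; exists x.
by right; exists x.
Qed.

Lemma pushout_openP (U : set pushout) :
  open U <-> open (pushout_inl @^-1` U) /\ open (pushout_inr @^-1` U).
Proof.
split=> [oU|[oB oC]].
  split; apply: open_comp => // x _.
    exact: pushout_inl_continuous.
  exact: pushout_inr_continuous.
by apply/sigT_openP => -[].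
Qed.

Lemma pushout_closedP (F : set pushout) :
  closed F <-> closed (pushout_inl @^-1` F) /\ closed (pushout_inr @^-1` F).
Proof.
have E (T : topologicalType) (H : set T) : closed H = open (~` H) by rewrite openC.
rewrite !E; exact: pushout_openP.
Qed.

Section UniversalProperty.
Context {Z : topologicalType} (h : B -> Z) (k : C -> Z).
Hypothesis hk : forall a, h (f a) = k (g a).

Let hk_sum (x : {b & summand b}) : Z :=
  match x with existT b y =>
    (if b return summand b -> Z then h else k) y
  end.

Definition pushout_desc (z : pushout) : Z := hk_sum (repr z).

Let pushout_descE (x : {b & summand b}) :
  pushout_desc (\pi_pushout x) = hk_sum x.
Proof.
rewrite /pushout_desc; have /eqmodP/asboolP : repr (\pi_pushout x) = x %[mod pushout].
  by rewrite reprK.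
move: (repr _) => y; elim=> [_ _ [a]|//|x1 x2 _ ->//|x1 x2 x3 _ -> _ ->//].
exact: hk.
Qed.

Lemma pushout_desc_inl x : pushout_desc (pushout_inl x) = h x.
Proof. exact: pushout_descE. Qed.

Lemma pushout_desc_inr y : pushout_desc (pushout_inr y) = k y.
Proof. exact: pushout_descE. Qed.

Lemma pushout_desc_continuous :
  continuous h -> continuous k -> continuous pushout_desc.
Proof.
move=> /continuousP ch /continuousP ck; apply/continuousP => U oU.
apply/pushout_openP; split; rewrite -comp_preimage.
  by rewrite (_ : _ \o _ = h); [exact: ch|apply/funext => ?; exact: pushout_desc_inl].
by rewrite (_ : _ \o _ = k); [exact: ck|apply/funext => ?; exact: pushout_desc_inr].
Qed.

End UniversalProperty.

Section Injective.
Hypotheses (f_inj : injective f) (g_inj : injective g).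

Let glued_sym (x y : {b & summand b}) : Prop :=
  [\/ x = y, glued x y | glued y x].

Let pushout_eqP (x y : {b & summand b}) :
  \pi_pushout x = \pi_pushout y -> glued_sym x y.
Proof.
move=> /eqmodP/asboolP; elim=> {x y} [x y xy|x|x y _ xy|x y z _ xy _ yz].
- exact: Or32.
- exact: Or31.
- by case: xy => [->|?|?]; [exact: Or31|exact: Or33|exact: Or32].
- case: xy yz => [->//|xy|yx]; case=> [<-|yz|zy].
  + exact: Or32.
  + by case: xy yz => a; move yE: (inC _) => y' yz; case: yz yE.
  + apply: Or31; case: xy zy => a; move yE: (inC _) => y' zy.
    by case: zy yE => a' /inC_inj /g_inj ->.
  + exact: Or33.
  + apply: Or31; case: yx yz => a; move yE: (inB _) => y' yz.
    by case: yz yE => a' /inB_inj /f_inj ->.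
  + by case: yx zy => a; move yE: (inB _) => y' zy; case: zy yE.
Qed.

Lemma pushout_inl_inj : injective pushout_inl.
Proof.
move=> x y /pushout_eqP[/inB_inj//||].
  by move yE: (inB y) => t s; case: s yE.
by move xE: (inB x) => t s; case: s xE.
Qed.

Lemma pushout_inr_inj : injective pushout_inr.
Proof.
move=> x y /pushout_eqP[/inC_inj//||].
  by move xE: (inC x) => t s; case: s xE.
by move yE: (inC y) => t s; case: s yE.
Qed.

Lemma pushout_inl_inr x y :
  pushout_inl x = pushout_inr y -> exists2 a, x = f a & y = g a.
Proof.
move=> /pushout_eqP[//||]; move xE: (inB x) => s; move yE: (inC y) => t st.
  by case: st xE yE => a /inB_inj -> /inC_inj ->; exists a.
by case: st xE yE.
Qed.

End Injective.
End Pushout.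

Definition closed_map {S T : topologicalType} (f : S -> T) : Prop :=
  forall F : set S, closed F -> closed (f @` F).

Record bispace := Bispace {
  sp0 : topologicalType;
  sp1 : topologicalType;
  umap : continuousType sp0 sp1;
  vmap : continuousType sp0 sp1;
  umap_inj : injective umap;
  vmap_inj : injective vmap;
  umap_closed : closed_map umap;
  vmap_closed : closed_map vmap;
  uv_disjoint : range umap `&` range vmap = set0
}.

Record bispace_hom (X X' : bispace) := BispaceHom {
  hom0 : continuousType (sp0 X) (sp0 X');
  hom1 : continuousType (sp1 X) (sp1 X');
  hom_u : forall x, hom1 (umap X x) = umap X' (hom0 x);
  hom_v : forall x, hom1 (vmap X x) = vmap X' (hom0 x)
}.

Lemma bispace_hom_eq (X X' : bispace) (h k : bispace_hom X X') :
  hom0 h =1 hom0 k -> hom1 h =1 hom1 k -> h = k.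
Proof.
case: h k => [h0 h1 hu hv] [k0 k1 ku kv] /= /continuousEP h0k0 /continuousEP h1k1.
rewrite {}h0k0 {}h1k1 in hu hv *.
by rewrite (Prop_irrelevance hu ku) (Prop_irrelevance hv kv).
Qed.

Definition bispace_id (X : bispace) : bispace_hom X X :=
  @BispaceHom X X idfun idfun (fun=> erefl) (fun=> erefl).

Program Definition bispace_comp (X Y Z : bispace)
    (g : bispace_hom Y Z) (f : bispace_hom X Y) : bispace_hom X Z :=
  @BispaceHom X Z (hom0 g \o hom0 f) (hom1 g \o hom1 f) _ _.
Next Obligation. by move=> X Y Z g f x /=; rewrite !hom_u. Qed.
Next Obligation. by move=> X Y Z g f x /=; rewrite !hom_v. Qed.

Program Definition bispace_category : category :=
  @Category bispace bispace_hom bispace_id bispace_comp _ _ _.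
Next Obligation. by move=> X Y f; exact: bispace_hom_eq. Qed.
Next Obligation. by move=> X Y f; exact: bispace_hom_eq. Qed.
Next Obligation. by move=> W X Y Z h g f; exact: bispace_hom_eq. Qed.

Section GluedBispace.
Variable X : bispace.

Definition glue1 : topologicalType := pushout (vmap X) (umap X).
Definition gluel : continuousType (sp1 X) glue1 :=
  pushout_inl (vmap X) (umap X).
Definition gluer : continuousType (sp1 X) glue1 :=
  pushout_inr (vmap X) (umap X).

Lemma gluel_v x : gluel (vmap X x) = gluer (umap X x).
Proof. exact: pushout_glue. Qed.

Lemma gluel_inj : injective gluel.
Proof. exact: (pushout_inl_inj (@vmap_inj X) (@umap_inj X)). Qed.

Lemma gluer_inj : injective gluer.
Proof. exact: (pushout_inr_inj (@vmap_inj X) (@umap_inj X)). Qed.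

Lemma gluel_eq_gluer x y :
  gluel x = gluer y -> exists2 a, x = vmap X a & y = umap X a.
Proof. exact: (pushout_inl_inr (@vmap_inj X) (@umap_inj X)). Qed.

Lemma gluel_closed : closed_map gluel.
Proof.
move=> F cF; apply/pushout_closedP; split.
  rewrite (_ : _ @^-1` _ = F)//; apply/seteqP; split=> [x /= [y Fy]|x Fx].
    by move=> /gluel_inj <-.
  by exists x.
rewrite (_ : _ @^-1` _ = umap X @` (vmap X @^-1` F)).
  by apply: umap_closed; apply: preimage_closed => // ? _; exact: cts_fun.
apply/seteqP; split=> [y /= [x Fx]|y /= [a Fa <-]].
  by move=> /gluel_eq_gluer[a xE ->]; exists a => //=; rewrite -xE.
by exists (vmap X a) => //; exact: gluel_v.
Qed.

Lemma gluer_closed : closed_map gluer.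
Proof.
move=> F cF; apply/pushout_closedP; split; last first.
  rewrite (_ : _ @^-1` _ = F)//; apply/seteqP; split=> [x /= [y Fy]|x Fx].
    by move=> /gluer_inj <-.
  by exists x.
rewrite (_ : _ @^-1` _ = vmap X @` (umap X @^-1` F)).
  by apply: vmap_closed; apply: preimage_closed => // ? _; exact: cts_fun.
apply/seteqP; split=> [x /= [y Fy] /esym|x /= [a Fa <-]].
  by move=> /gluel_eq_gluer[a -> yE]; exists a => //=; rewrite -yE.
by exists (umap X a) => //; rewrite -gluel_v.
Qed.

Program Definition glue_bispace : bispace :=
  @Bispace (sp0 X) glue1 (gluel \o umap X) (gluer \o vmap X) _ _ _ _ _.
Next Obligation. exact: inj_comp gluel_inj (@umap_inj X). Qed.
Next Obligation. exact: inj_comp gluer_inj (@vmap_inj X). Qed.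
Next Obligation.
by move=> F cF; rewrite -image_comp; apply/gluel_closed/umap_closed.
Qed.
Next Obligation.
by move=> F cF; rewrite -image_comp; apply/gluer_closed/vmap_closed.
Qed.
Next Obligation.
apply/seteqP; split=> // _ [/= [x _ <-] [y _ /= /esym /gluel_eq_gluer[a xE _]]].
have : (range (umap X) `&` range (vmap X)) (umap X x).
  by split; [exists x|rewrite xE; exists a].
by rewrite uv_disjoint.
Qed.

End GluedBispace.

Section GluedHom.
Variables (X Y : bispace) (h : bispace_hom X Y).

Definition glue_fun1 : glue1 X -> glue1 Y :=
  pushout_desc (gluel Y \o hom1 h) (gluer Y \o hom1 h).

Let compat a :
  (gluel Y \o hom1 h) (vmap X a) = (gluer Y \o hom1 h) (umap X a).
Proof. by rewrite /= hom_u hom_v gluel_v. Qed.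

Lemma glue_fun1l x : glue_fun1 (gluel X x) = gluel Y (hom1 h x).
Proof. exact: (pushout_desc_inl compat). Qed.

Lemma glue_fun1r x : glue_fun1 (gluer X x) = gluer Y (hom1 h x).
Proof. exact: (pushout_desc_inr compat). Qed.

Lemma glue_fun1_continuous : continuous glue_fun1.
Proof. by apply: (pushout_desc_continuous compat); exact: cts_fun. Qed.

Program Definition glue_hom : bispace_hom (glue_bispace X) (glue_bispace Y) :=
  @BispaceHom (glue_bispace X) (glue_bispace Y)
    (hom0 h) (mkcts glue_fun1_continuous) _ _.
Next Obligation. by move=> x /=; rewrite /mkcts glue_fun1l hom_u. Qed.
Next Obligation. by move=> x /=; rewrite /mkcts glue_fun1r hom_v. Qed.

End GluedHom.

Program Definition glue_functor : endofunctor bispace_category :=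
  @Endofunctor bispace_category glue_bispace glue_hom _ _.
Next Obligation.
move=> X; apply: bispace_hom_eq => // z /=; rewrite /mkcts.
by have [[x ->]|[x ->]] := pushoutP z; [exact: glue_fun1l|exact: glue_fun1r].
Qed.
Next Obligation.
move=> X Y Z g f; apply: bispace_hom_eq => // z /=; rewrite /mkcts.
have [[x ->]|[x ->]] := pushoutP z.
  by rewrite [LHS]glue_fun1l [X in glue_fun1 g X]glue_fun1l [RHS]glue_fun1l.
by rewrite [LHS]glue_fun1r [X in glue_fun1 g X]glue_fun1r [RHS]glue_fun1r.
Qed.

Section IntervalCoalgebra.
Variable R : realType.

Definition itv (a b : R) : topologicalType := set_type `[a, b].

Section ItvPoints.
Variables a b : R.

Lemma itv_mem (t : R) : a <= t <= b -> t \in `[a, b]%classic.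
Proof. by move=> h; rewrite inE /= in_itv. Qed.

Definition itv_pt (t : R) (h : a <= t <= b) : itv a b :=
  exist _ t (itv_mem h).

Definition itv_val (x : itv a b) : R := sval x.

Lemma itv_valP (x : itv a b) : a <= itv_val x <= b.
Proof. by case: x => t /=; rewrite inE /= in_itv. Qed.

Lemma itv_val_inj : injective itv_val.
Proof. by move=> x y; exact: eq_sig_hprop. Qed.

Lemma itv_val_continuous : continuous itv_val.
Proof. exact: (@initial_continuous (set_type `[a, b]) R set_val). Qed.

Lemma itv_continuous (T : topologicalType) (f : T -> itv a b) :
  continuous (itv_val \o f) -> continuous f.
Proof.
exact: (@continuous_comp_initial (set_type `[a, b]) T R set_val f).
Qed.

Lemma itv_closedP (F : set (itv a b)) :
  closed F -> exists2 H : set R, closed H & F = itv_val @^-1` H.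
Proof.
rewrite -openC => -[U oU UE]; exists (~` U); first exact: open_closedC.
by rewrite -[F]setCK -UE.
Qed.

Lemma itv_closed_set1 (x : itv a b) : closed [set x].
Proof.
rewrite (_ : [set x] = itv_val @^-1` [set itv_val x]).
  apply: preimage_closed; last exact: closed_eq.
  by move=> ? _; exact: itv_val_continuous.
by apply/seteqP; split=> [y -> //|y /= /itv_val_inj].
Qed.

End ItvPoints.

Lemma itv_shift_closed (a b c d k : R) (f : itv a b -> itv c d) :
  (forall x, itv_val (f x) = itv_val x + k) -> closed_map f.
Proof.
move=> fE F /itv_closedP[H cH ->].
rewrite (_ : _ @` _ = (fun y : itv c d => itv_val y - k) @^-1` (H `&` `[a, b])).
  apply: preimage_closed; last by apply: closedI => //; exact: itv_closed.
  move=> y _; apply: continuousB; [exact: itv_val_continuous|exact: cst_continuous].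
apply/seteqP; split=> [_ /= [x Hx <-]|y /= [Hy yab]].
  by rewrite fE addrK; split=> //; rewrite in_itv; exact: itv_valP.
rewrite in_itv /= in yab.
by exists (itv_pt yab) => //; apply: itv_val_inj; rewrite fE /= subrK.
Qed.

Let le01 : 0 <= (0 : R) <= 1. Proof. by rewrite lexx ler01. Qed.
Let le11 : 0 <= (1 : R) <= 1. Proof. by rewrite lexx ler01. Qed.
Let le02 : 0 <= (0 : R) <= 2. Proof. by rewrite lexx ler0n. Qed.
Let le22 : 0 <= (2 : R) <= 2. Proof. by rewrite lexx ler0n. Qed.

Lemma itv_cst_closed_map (T : topologicalType) (a b : R) (x : itv a b) :
  closed_map (cst x : T -> itv a b).
Proof.
move=> F _; have [->|/set0P[t Ft]] := eqVneq F set0.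
  by rewrite image_set0; exact: closed0.
rewrite (_ : _ @` F = [set x]); first exact: itv_closed_set1.
by apply/seteqP; split=> [_ [_ _ <-]//|_ ->]; exists t.
Qed.

Program Definition unit_interval : bispace :=
  @Bispace (discrete_topology unit) (itv 0 1)
    (cst (itv_pt le01)) (cst (itv_pt le11)) _ _ _ _ _.
Next Obligation. by move=> [] []. Qed.
Next Obligation. by move=> [] []. Qed.
Next Obligation. exact: itv_cst_closed_map. Qed.
Next Obligation. exact: itv_cst_closed_map. Qed.
Next Obligation.
apply/seteqP; split=> // _ [/= [? _ <-] [? _ /(congr1 (@itv_val 0 1))]] /= /eqP.
by rewrite oner_eq0.
Qed.

(* The pushout [glue1 unit_interval] is identified with [0, 2] through the homeomorphism
   [glued_to_itv], with inverse [itv_to_glued], given by t |-> t on the left copy of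
   [0, 1] and by t |-> t + 1 on the right copy. *)

Lemma itv_left_subproof (x : itv 0 1) : 0 <= itv_val x <= 2.
Proof. by have := itv_valP x; lra. Qed.

Lemma itv_right_subproof (x : itv 0 1) : 0 <= itv_val x + 1 <= 2.
Proof. by have := itv_valP x; lra. Qed.

Definition itv_left (x : itv 0 1) : itv 0 2 := itv_pt (itv_left_subproof x).
Definition itv_right (x : itv 0 1) : itv 0 2 := itv_pt (itv_right_subproof x).

Lemma itv_left_continuous : continuous itv_left.
Proof. by apply: itv_continuous; exact: itv_val_continuous. Qed.

Lemma itv_right_continuous : continuous itv_right.
Proof.
apply: itv_continuous => x.
by apply: continuousD; [exact: itv_val_continuous|exact: cst_continuous].
Qed.

Lemma itv_left_right a :
  itv_left (vmap unit_interval a) = itv_right (umap unit_interval a).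
Proof. by apply: itv_val_inj; rewrite /= add0r. Qed.

Definition glued_to_itv : glue1 unit_interval -> itv 0 2 :=
  pushout_desc itv_left itv_right.

Lemma glued_to_itvl x : glued_to_itv (gluel unit_interval x) = itv_left x.
Proof. exact: (pushout_desc_inl itv_left_right). Qed.

Lemma glued_to_itvr x : glued_to_itv (gluer unit_interval x) = itv_right x.
Proof. exact: (pushout_desc_inr itv_left_right). Qed.

Lemma glued_to_itv_continuous : continuous glued_to_itv.
Proof.
apply: (pushout_desc_continuous itv_left_right).
  exact: itv_left_continuous.
exact: itv_right_continuous.
Qed.

Lemma itv_to_glued_subproof1 (s : itv 0 2) :
  itv_val s <= 1 -> 0 <= itv_val s <= 1.
Proof. by have := itv_valP s; lra. Qed.

Lemma itv_to_glued_subproof2 (s : itv 0 2) :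
  ~ itv_val s <= 1 -> 0 <= itv_val s - 1 <= 1.
Proof. by have := itv_valP s => + /negP; rewrite -ltNge; lra. Qed.

Definition itv_to_glued (s : itv 0 2) : glue1 unit_interval :=
  match pselect (itv_val s <= 1) with
  | left h => gluel unit_interval (itv_pt (itv_to_glued_subproof1 h))
  | right h => gluer unit_interval (itv_pt (itv_to_glued_subproof2 h))
  end.

Lemma itv_to_gluedK : cancel itv_to_glued glued_to_itv.
Proof.
move=> s; apply: itv_val_inj; rewrite /itv_to_glued.
case: pselect => h.
  by rewrite glued_to_itvl.
by rewrite glued_to_itvr /= subrK.
Qed.

Lemma glued_to_itv_inj : injective glued_to_itv.
Proof.
have lr x y : itv_left x = itv_right y ->
    gluel unit_interval x = gluer unit_interval y.
  move=> /(congr1 (@itv_val 0 2)) /= xy.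
  have x1 : x = vmap unit_interval tt.
    by apply: itv_val_inj => /=; have := itv_valP x; have := itv_valP y; lra.
  have y0 : y = umap unit_interval tt.
    by apply: itv_val_inj => /=; have := itv_valP x; have := itv_valP y; lra.
  by rewrite x1 y0; exact: (@gluel_v unit_interval tt).
move=> z w; have [[x ->]|[x ->]] := pushoutP z;
  have [[y ->]|[y ->]] := pushoutP w;
  rewrite ?[X in X = _]glued_to_itvl ?[X in X = _]glued_to_itvr
    ?[X in _ = X]glued_to_itvl ?[X in _ = X]glued_to_itvr.
- move=> /(congr1 (@itv_val 0 2)) /= xy.
  by congr pushout_inl; exact: itv_val_inj.
- exact: lr.
- by move=> /esym /lr /esym.
- move=> /(congr1 (@itv_val 0 2)) /= /addIr xy.
  by congr pushout_inr; exact: itv_val_inj.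
Qed.

Lemma glued_to_itvK : cancel glued_to_itv itv_to_glued.
Proof. by move=> z; apply: glued_to_itv_inj; rewrite itv_to_gluedK. Qed.

Lemma itv_to_glued_continuous : continuous itv_to_glued.
Proof.
apply/continuous_closedP => F /pushout_closedP[cl cr].
rewrite (_ : _ @^-1` F =
    itv_left @` (gluel unit_interval @^-1` F) `|`
    itv_right @` (gluer unit_interval @^-1` F)).
  apply: closedU.
    by apply: (@itv_shift_closed _ _ _ _ 0) => // x; rewrite addr0.
  exact: (@itv_shift_closed _ _ _ _ 1).
apply/seteqP; split=> [s /= Fs|s /= [[x Fx <-]|[x Fx <-]]].
- have := itv_to_gluedK s; move: Fs.
  have [[x ->]|[x ->]] := pushoutP (itv_to_glued s).
    by rewrite [X in _ -> X = _ -> _]glued_to_itvl => Fx <-; left; exists x.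
  by rewrite [X in _ -> X = _ -> _]glued_to_itvr => Fx <-; right; exists x.
- by rewrite -glued_to_itvl glued_to_itvK.
- by rewrite -glued_to_itvr glued_to_itvK.
Qed.

Lemma itv_to_glued0 :
  itv_to_glued (itv_pt le02) = umap (glue_bispace unit_interval) tt.
Proof.
apply: glued_to_itv_inj; rewrite itv_to_gluedK glued_to_itvl.
exact: itv_val_inj.
Qed.

Lemma itv_to_glued2 :
  itv_to_glued (itv_pt le22) = vmap (glue_bispace unit_interval) tt.
Proof.
apply: glued_to_itv_inj; rewrite itv_to_gluedK glued_to_itvr.
by apply: itv_val_inj.
Qed.

Lemma doubling_subproof (t : itv 0 1) : 0 <= 2 * itv_val t <= 2.
Proof. by have := itv_valP t; lra. Qed.

Definition doubling (t : itv 0 1) : itv 0 2 := itv_pt (doubling_subproof t).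

Lemma doubling_continuous : continuous doubling.
Proof.
apply: itv_continuous => x.
by apply: (@continuousM R _ (cst 2) (@itv_val 0 1));
  [exact: cst_continuous|exact: itv_val_continuous].
Qed.

Lemma iota1_continuous : continuous (itv_to_glued \o doubling).
Proof.
move=> x; apply: continuous_comp.
  exact: doubling_continuous.
exact: itv_to_glued_continuous.
Qed.

(* Under this identification, the second component is t |-> 2 t. *)
Program Definition interval_iota : bispace_hom unit_interval (glue_bispace unit_interval) :=
  @BispaceHom unit_interval (glue_bispace unit_interval)
    idfun (mkcts iota1_continuous) _ _.
Next Obligation.
move=> [] /=; rewrite -[RHS]itv_to_glued0; congr itv_to_glued.
by apply: itv_val_inj; rewrite /= mulr0.
Qed.
Next Obligation.
move=> [] /=; rewrite -[RHS]itv_to_glued2; congr itv_to_glued.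
by apply: itv_val_inj; rewrite /= mulr1.
Qed.

Definition interval_coalgebra : coalgebra glue_functor :=
  @Coalgebra bispace_category glue_functor unit_interval interval_iota.

End IntervalCoalgebra.

(* Main.v *)
Require Import Defs.
From mathcomp Require Import all_boot all_order all_algebra.
From mathcomp Require Import all_classical all_reals all_analysis.
From mathcomp Require Import lra.

Set Implicit Arguments.
Unset Strict Implicit.
Unset Printing Implicit Defensive.

Import Order.TTheory GRing.Theory Num.Theory.
Import numFieldNormedType.Exports.

Local Open Scope classical_set_scope.
Local Open Scope ring_scope.

(** Why the interval is terminal.

A map of coalgebras from (X, xi) to the interval has no freedom on X_0, so it
amounts to a continuous function f : X_1 -> [0, 1] with f u = 0 and f v = 1 such
that 2 f(x) is the value at xi(x) of the function on the glued space which is f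
on the left copy of X_1 and f + 1 on the right copy.  In other words, f is a
fixed point of the operator [average], which glues f with f + 1, pulls the
result back along xi and halves it ([interval_coalgebra_homP]).

Forget continuity at first.  The operator preserves the set of all functions
f : X_1 -> [0, 1] with f u = 0 and f v = 1, and because of the final division
by 2 it is a contraction of factor 1/2 there; hence it has at most one fixed
point ([average_fixpoint_unique]).  One exists because the iterates of the
operator, started at the indicator function of the image of v, increase to a
limit ([average_fixpoint_exists]).

The crux is that the fixed point is continuous, although X_1 is an arbitrary
space, which may carry no continuous function separating the images of u and v
that an iteration could start from.  Suppose that every point x of X_1 has a
neighbourhood on which f differs from f(x) by at most e.  Then so does the
glued function at every point z of the glued space: since u and v are closed
maps, so are the two coprojections, hence neighbourhoods in X_1 of the preimages
of z on either side glue to a neighbourhood of z ([nbhs_glue]).  Deviations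
being measured from the value at the centre, the two sides of a gluing point do
not add up, and the same e works.  Pulling back along xi and halving, f differs
from f(x) by at most e/2 near x.  As e = 1 is admissible, e can be made
arbitrarily small ([average_fixpoint_continuous]). *)

(** * Halving induction *)

(** The common end of the uniqueness and the continuity arguments: both show
that an error bound can be halved. *)
Lemma halving_induction (R : realType) (P : R -> Prop) :
  P 1 -> (forall e, P e -> P (e / 2)) ->
  forall e, 0 < e -> exists2 d, d <= e & P d.
Proof.
move=> P1 P2 e e0.
have [N _ /(_ N (leqnn N)) /ltW Ne] := near_infty_natSinv_expn_lt (PosNum e0).
exists (1 / 2 ^+ N) => //; elim: N {Ne} => [|N IH]; first by rewrite expr0 divr1.
by rewrite exprSr invfM mulrA; exact: P2.
Qed.

(** * Neighbourhoods in the glued space *)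

Section GluedSpace.
Variable X : bispace.

Lemma glueP (z : Defs.glue1 X) :
  (exists x, z = gluel X x) \/ (exists y, z = gluer X y).
Proof. exact: pushoutP. Qed.

(** The glued neighbourhood is the complement of the union of the images of the
two complements, which is open because the coprojections are closed maps.  A
point z with no preimage on one of the sides needs no separate treatment. *)
Lemma nbhs_glue (z : Defs.glue1 X) (P : set (Defs.glue1 X)) :
  (forall x, z = gluel X x -> \forall x' \near x, P (gluel X x')) ->
  (forall y, z = gluer X y -> \forall y' \near y, P (gluer X y')) ->
  \forall z' \near z, P z'.
Proof.
move=> Pl Pr.
pose V := (gluel X @^-1` P)^°; pose W := (gluer X @^-1` P)^°.
have oE : open (~` (gluel X @` (~` V) `|` gluer X @` (~` W))).
  apply: closed_openC; apply: closedU.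
    by apply: gluel_closed; apply: open_closedC; exact: open_interior.
  by apply: gluer_closed; apply: open_closedC; exact: open_interior.
have : nbhs z (~` (gluel X @` (~` V) `|` gluer X @` (~` W))).
  apply: open_nbhs_nbhs; split=> // -[[x nVx xz]|[y nWy yz]].
    by apply: nVx; exact/Pl/esym.
  by apply: nWy; exact/Pr/esym.
apply: filterS => z' nz'.
have [[x zE]|[y zE]] := glueP z'; rewrite zE in nz' *.
  suff /interior_subset : V x by [].
  by apply: contrapT => nVx; apply: nz'; left; exists x.
suff /interior_subset : W y by [].
by apply: contrapT => nWy; apply: nz'; right; exists y.
Qed.

End GluedSpace.

(** * Separating functions and the averaging operator *)

Section Averaging.
Variables (R : realType) (X : bispace).
Implicit Types f g : sp1 X -> R.

(** These are the underlying functions of bispace maps from X to the interval,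
without the continuity, which is only established for the fixed point. *)
Definition separating f : Prop :=
  [/\ forall x, 0 <= f x <= 1,
      forall a, f (umap X a) = 0 & forall a, f (vmap X a) = 1].

Definition glue_real f : Defs.glue1 X -> R :=
  pushout_desc (f : sp1 X -> (R : topologicalType)) (fun y => f y + 1).

Lemma glue_compat f : separating f ->
  forall a, f (vmap X a) = f (umap X a) + 1.
Proof. by move=> [_ fu fv] a; rewrite fu fv add0r. Qed.

Lemma glue_real_l f x : separating f -> glue_real f (gluel X x) = f x.
Proof. by move=> /glue_compat sf; exact: (pushout_desc_inl sf). Qed.

Lemma glue_real_r f y : separating f -> glue_real f (gluer X y) = f y + 1.
Proof. by move=> /glue_compat sf; exact: (pushout_desc_inr sf). Qed.

Lemma dist_glue_real f g e :
  separating f -> separating g -> (forall x, `|f x - g x| <= e) ->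
  forall z, `|glue_real f z - glue_real g z| <= e.
Proof.
move=> sf sg fg z; have [[x ->]|[y ->]] := glueP z.
  by rewrite !glue_real_l.
by rewrite !glue_real_r// opprD addrACA subrr addr0.
Qed.

Variable xi : bispace_hom X (glue_bispace X).

Definition average f (x : sp1 X) : R := glue_real f (hom1 xi x) / 2.

(** The values at u and v are preserved because xi maps u into the left copy at
u, where the glued function is 0, and v into the right copy at v, where it
is 2. *)
Lemma average_separating f : separating f -> separating (average f).
Proof.
move=> sf; have [f01 fu fv] := sf; split=> [x|a|a].
- rewrite /average; have [[y ->]|[y ->]] := glueP (hom1 xi x).
    by rewrite glue_real_l//; have := f01 y; lra.
  by rewrite glue_real_r//; have := f01 y; lra.
- by rewrite /average hom_u glue_real_l// fu mul0r.
- by rewrite /average hom_v glue_real_r// fv; lra.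
Qed.

Lemma le_average f g : separating f -> separating g ->
  (forall x, f x <= g x) -> forall x, average f x <= average g x.
Proof.
move=> sf sg fg x; rewrite /average ler_pM2r ?invr_gt0//.
have [[y ->]|[y ->]] := glueP (hom1 xi x).
  by rewrite !glue_real_l.
by rewrite !glue_real_r// lerD2r.
Qed.

(** The operator halves the uniform distance between separating functions, which
is at most 1 to begin with. *)
Lemma average_fixpoint_unique f g : separating f -> separating g ->
  average f =1 f -> average g =1 g -> f =1 g.
Proof.
move=> sf sg fE gE.
pose P (e : R) := forall x, `|f x - g x| <= e.
have P1 : P 1.
  move=> x; have [/(_ x) ? _ _] := sf; have [/(_ x) ? _ _] := sg.
  by rewrite ler_norml; lra.
have P2 e : P e -> P (e / 2).
  move=> Pe x; rewrite -fE -gE /average -mulrBl normrM [`|2^-1|]gtr0_norm//.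
  by rewrite ler_pM2r//; exact: dist_glue_real.
move=> x; apply/eqP; rewrite -subr_eq0 -normr_le0; apply/ler_addgt0Pr => e e0.
have [d de Pd] := halving_induction P1 P2 e0.
by rewrite add0r; exact: le_trans (Pd x) de.
Qed.

(** Bounding the deviation from the value at the centre of a neighbourhood,
rather than the oscillation over it, is what lets the bound survive gluing: at a
gluing point a nearby point lies in one copy only, and is compared with the
common value of the two sides. *)
Lemma average_fixpoint_continuous f : separating f -> average f =1 f ->
  continuous (f : sp1 X -> (R : topologicalType)).
Proof.
move=> sf fE.
pose P (e : R) := forall x, \forall y \near x, `|f x - f y| <= e.
have P1 : P 1.
  move=> x; apply: nearW => y; have [f01 _ _] := sf.
  by have := f01 x; have := f01 y; rewrite ler_norml; lra.
have P2 e : P e -> P (e / 2).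
  move=> Pe x.
  have Pz : \forall z \near hom1 xi x,
      `|glue_real f (hom1 xi x) - glue_real f z| <= e.
    apply: nbhs_glue => [x' ->|y' ->].
      by apply: filterS (Pe x') => w; rewrite !glue_real_l.
    apply: filterS (Pe y') => w.
    by rewrite !glue_real_r// opprD addrACA subrr addr0.
  have : \forall y \near x,
      `|glue_real f (hom1 xi x) - glue_real f (hom1 xi y)| <= e.
    exact: (@cts_fun _ _ (hom1 xi) x _ Pz).
  apply: filterS => y xy.
  rewrite -(fE x) -(fE y) /average -mulrBl normrM [`|2^-1|]gtr0_norm//.
  by rewrite ler_pM2r.
move=> x; apply/cvgrPdist_le => e e0.
have [d de Pd] := halving_induction P1 P2 e0.
by apply: filterS (Pd x) => y xy; exact: le_trans xy de.
Qed.

(** The starting point is the least separating function, so that the iterates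
of the monotone operator increase. *)
Definition approx (n : nat) : sp1 X -> R := iter n average (\1_(range (vmap X))).

Lemma approx_separating n : separating (approx n).
Proof.
elim: n => [|n IH]; last exact: average_separating.
split=> [x|a|a]; rewrite /approx /= indicE.
- by case: (_ \in _); rewrite ?lexx ?ler01.
- rewrite memNset// => av.
  have : (range (umap X) `&` range (vmap X)) (umap X a) by split => //; exists a.
  by rewrite uv_disjoint.
- by rewrite mem_set//; exists a.
Qed.

Lemma approx_nondecreasing x : nondecreasing_seq (approx ^~ x).
Proof.
apply/nondecreasing_seqP => n; elim: n x => [x|n IH x].
  have [/(_ x)/andP[a0 _] _ av] := approx_separating 1.
  rewrite [leLHS]indicE; have [[a _ <-]|xv] := pselect (range (vmap X) x).
    by rewrite av lern1 leq_b1.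
  by rewrite memNset.
exact: (le_average (approx_separating n) (approx_separating n.+1)).
Qed.

Lemma approx_cvg x : cvgn (approx ^~ x).
Proof.
apply: nondecreasing_is_cvgn; first exact: approx_nondecreasing.
exists 1 => _ [n _ <-].
by have [/(_ x)/andP[]] := approx_separating n.
Qed.

Lemma average_fixpoint_exists :
  exists2 f : sp1 X -> R, separating f & average f =1 f.
Proof.
pose f x : R := limn (approx ^~ x).
have sf : separating f.
  split=> [x|a|a].
  - apply/andP; split; [apply: limr_ge|apply: limr_le]; try exact: approx_cvg.
      by apply: nearW => n; have [/(_ x)/andP[]] := approx_separating n.
    by apply: nearW => n; have [/(_ x)/andP[]] := approx_separating n.
  - rewrite /f (_ : (approx ^~ _) = cst 0) ?lim_cst//.
    by apply/funext => n; have [] := approx_separating n.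
  - rewrite /f (_ : (approx ^~ _) = cst 1) ?lim_cst//.
    by apply/funext => n; have [] := approx_separating n.
exists f => // x.
have fx : approx n.+1 x @[n --> \oo] --> f x.
  by rewrite (cvg_shiftS (approx ^~ x)); exact: approx_cvg.
suff Tfx : average (approx n) x @[n --> \oo] --> average f x.
  exact: (cvg_unique _ Tfx fx).
apply: cvgMl; have [[y ->]|[y ->]] := glueP (hom1 xi x).
  rewrite glue_real_l//.
  rewrite (_ : (fun=> _) = approx ^~ y); first exact: approx_cvg.
  by apply/funext => n; rewrite glue_real_l//; exact: approx_separating.
rewrite glue_real_r//.
rewrite (_ : (fun=> _) = fun n => approx n y + 1); last first.
  by apply/funext => n; rewrite glue_real_r//; exact: approx_separating.
by apply: cvgD; [exact: approx_cvg|exact: cvg_cst].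
Qed.

End Averaging.

(** * Coalgebra maps into the interval *)

Section MapsToInterval.
Variables (R : realType) (X : bispace).

Lemma interval_hom_separating (h : bispace_hom X (unit_interval R)) :
  separating (fun x => itv_val (hom1 h x)).
Proof.
by split=> [x|a|a]; [exact: itv_valP|rewrite hom_u|rewrite hom_v].
Qed.

Lemma glued_to_itv_glue_fun1 (h : bispace_hom X (unit_interval R)) z :
  itv_val (glued_to_itv (glue_fun1 h z)) =
  glue_real (fun x => itv_val (hom1 h x)) z.
Proof.
have sh := interval_hom_separating h.
have [[x ->]|[y ->]] := glueP z.
  by rewrite glue_real_l// glue_fun1l glued_to_itvl.
by rewrite glue_real_r// glue_fun1r glued_to_itvr.
Qed.

Variable xi : bispace_hom X (glue_bispace X).

(** Under the identification of the glued interval with [0, 2], the two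
composites send x to 2 h(x) and to the glued function at xi(x). *)
Lemma interval_coalgebra_homP (h : bispace_hom X (unit_interval R)) :
  bispace_comp (interval_iota R) h = bispace_comp (glue_hom h) xi <->
  average xi (fun x => itv_val (hom1 h x)) =1 (fun x => itv_val (hom1 h x)).
Proof.
split=> [hE x|hE].
  have /(congr1 (fun k : bispace_hom X (glue_bispace (unit_interval R)) =>
    itv_val (glued_to_itv (hom1 k x)))) := hE.
  rewrite /= /mkcts /= itv_to_gluedK glued_to_itv_glue_fun1 /= /average => <-.
  by rewrite mulrC mulKf.
apply: bispace_hom_eq => [a|x].
  by case: (hom0 _ a); case: (hom0 _ a).
apply: glued_to_itv_inj; apply: itv_val_inj.
rewrite /= /mkcts /= itv_to_gluedK glued_to_itv_glue_fun1 /=.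
by rewrite -hE /average mulrC divfK.
Qed.

End MapsToInterval.

Theorem theorem2p2 (R : realType) :
  @is_terminal (coalgebra_category glue_functor) (interval_coalgebra R).
Proof.
move=> [X xi].
have [f sf fE] := average_fixpoint_exists R xi.
have fc := average_fixpoint_continuous sf fE.
have [f01 fu fv] := sf.
pose F (x : sp1 X) : itv 0 1 := itv_pt (f01 x).
have Fc : continuous F by apply: itv_continuous; exact: fc.
pose c : sp0 X -> sp0 (unit_interval R) := cst tt.
have cc : continuous c by exact: cst_continuous.
have Fu a : F (umap X a) = umap (unit_interval R) (c a).
  by apply: itv_val_inj; exact: fu.
have Fv a : F (vmap X a) = vmap (unit_interval R) (c a).
  by apply: itv_val_inj; exact: fv.
pose h : bispace_hom X (unit_interval R) :=
  @BispaceHom X (unit_interval R) (mkcts cc) (mkcts Fc) Fu Fv.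
have hP : bispace_comp (interval_iota R) h = bispace_comp (glue_hom h) xi.
  exact/interval_coalgebra_homP.
exists (exist _ h hP) => -[g gP]; apply: coalgebra_hom_eq => /=.
apply: bispace_hom_eq => [a|x]; first by case: (hom0 g a); case: (hom0 h a).
apply: itv_val_inj.
move: x; apply: (average_fixpoint_unique (interval_hom_separating g) sf _ fE).
exact/interval_coalgebra_homP.
Qed.
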